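(* Let $\mathcal{C}$ be a precore clutter on a finite set $E$, and let $\mathcal{D}$ be an ideal minimally non-packing clutter on $E$ with $\tilde{\mathcal{D}}=\mathcal{C}$. Then for all disjoint $A,B\subseteq E$ with $A\cup B\neq\emptyset$, $\mathrm{bn}(\mathcal{C}/A\setminus B)\le\mathrm{pn}(\mathcal{D}/A\setminus B)$.
   Context: A clutter on $E$ is a family of subsets none containing another (members: hyperedges). A transversal is an inclusion-minimal subset meeting all hyperedges; $\mathrm{b}(\cdot)$ the transversals, $\mathrm{bn}(\cdot)$ the minimum transversal size, $\mathrm{minb}(\cdot)$ the minimum-size transversals; $\mathrm{pn}(\cdot)$ the maximum number of pairwise disjoint hyperedges; a clutter packs if $\mathrm{pn}=\mathrm{bn}$. $\mathcal{C}/A$ = minimal members of $\{X\setminus A:X\in\mathcal{C}\}$; $\mathcal{C}\setminus B=\{X\in\mathcal{C}:X\cap B=\emptyset\}$; minors arise by iterating these; minimally non-packing means not packing while every proper minor packs. Ideal: $\{x\ge0:\langle x,1_H\rangle\ge1\ \forall H\}$ is an integral polyhedron. Fractional packing: $y:\mathcal{C}\to\mathbb{R}_{\ge0}$ with $\sum_{H\ni a}y(H)\le1$; $\mathrm{fpn}$ the max of $\sum y(H)$; integral blocking condition: $\mathrm{fpn}=\mathrm{bn}$. $\tilde{\mathcal{C}}=\{H\in\mathcal{C}:|H\cap B|=1\ \forall B\in\mathrm{minb}(\mathcal{C})\}$. $\mathrm{I}(\mathcal{C})=\{x\in\mathbb{R}^E:\langle x,1_D\rangle=1\ \forall D\in\mathrm{minb}(\mathcal{C}),\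 \langle x,1_D\rangle\ge1\ \forall D\in\mathrm{b}(\mathcal{C}),\ x\ge0\}$. With $\mathcal{C}[F]=\{X\in\mathcal{C}:X\subseteq F\}$, non-separable means no partition $\{E_1,E_2\}$ of $E$ into nonempty parts has $\mathrm{bn}(\mathcal{C})=\mathrm{bn}(\mathcal{C}[E_1])+\mathrm{bn}(\mathcal{C}[E_2])$. A precore clutter is one with $\mathcal{C}=\tilde{\mathcal{C}}$, the integral blocking condition, $\mathrm{I}(\mathcal{C})$ an integral polytope, and non-separable. *)

(* Defs.v *)
From mathcomp Require Import all_boot all_order all_algebra.
From mathcomp Require Import boolp classical_sets reals constructive_ereal ereal.

Set Implicit Arguments.
Unset Strict Implicit.
Unset Printing Implicit Defensive.

Import Order.TTheory GRing.Theory Num.Theory.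
Local Open Scope ring_scope.

Section Clutters.
Variable E : finType.
Implicit Types (C D : {set {set E}}) (A B F X Y T : {set E}).

Definition clutter C : Prop :=
  forall X Y, X \in C -> Y \in C -> X \subset Y -> X = Y.

Definition meets_all C T : bool := [forall X in C, X :&: T != finset.set0].

(* b(C); empty when C contains the empty set. *)
Definition transversals C : {set {set E}} := [set T | minset (meets_all C) T]%SET.

Definition min_transversals C : {set {set E}} :=
  [set T in transversals C | [forall T' in transversals C, (#|T| <= #|T'|)%N]]%SET.

Definition minimal_members (S : {set {set E}}) : {set {set E}} :=
  [set X | minset (mem S) X]%SET.

Definition contraction C A : {set {set E}} :=
  minimal_members [set X :\: A | X in C]%SET.

Definition deletion C B : {set {set E}} := [set X in C | X :&: B == finset.set0]%SET.

Definition restrict C F : {set {set E}} := [set X in C | X \subset F]%SET.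

Definition core C : {set {set E}} :=
  [set X in C | [forall B in min_transversals C, #|X :&: B| == 1%N]]%SET.

(* [minor C G D]: the clutter D with ground set G is obtained from the clutter
   C with ground set E by iterated contractions and deletions.  The ground set
   is recorded because removing an element that lies in no hyperedge does not
   change the family of hyperedges, yet it yields a proper minor. *)
Inductive minor C : {set E} -> {set {set E}} -> Prop :=
| minor_refl : minor C [set: E]%SET C
| minor_contract G D A :
    minor C G D -> A \subset G -> minor C (G :\: A) (contraction D A)
| minor_delete G D B :
    minor C G D -> B \subset G -> minor C (G :\: B) (deletion D B).

Definition proper_minor C D : Prop := exists2 G, minor C G D & G != [set: E]%SET.

End Clutters.

Section Numbers.
Variables (R : realType) (E : finType).
Implicit Types (C D : {set {set E}}) (x : {ffun E -> R}).

(* The numbers bn, pn and fpn live in the extended reals.  The infimum and the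
   suprema below are attained minima and maxima, except for the clutter whose
   only hyperedge is the empty set: it has no transversal, and the empty set
   may be repeated arbitrarily often in a packing, so that bn = pn = fpn = +oo
   (for any other clutter, pairwise disjoint hyperedges are distinct, and
   indexing a packing by 'I_n amounts to choosing n distinct hyperedges). *)

Definition bn C : \bar R :=
  ereal_inf [set (#|T|%:R)%:E | T in [set` transversals C]]%classic.

Definition packing C (n : nat) (f : 'I_n -> {set E}) : Prop :=
  (forall i, f i \in C) /\ (forall i j, i != j -> [disjoint f i & f j]).

Definition pn C : \bar R :=
  ereal_sup [set (n%:R)%:E | n in fun n : nat => exists f, @packing C n f]%classic.

Definition packs C : Prop := pn C = bn C.

Definition minimally_nonpacking C : Prop :=
  ~ packs C /\ forall D, proper_minor C D -> packs D.

Definition fractional_packing C (y : {set E} -> R) : Prop :=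
  (forall H, H \in C -> 0 <= y H) /\
  (forall a, \sum_(H in C | a \in H) y H <= 1).

Definition fpn C : \bar R :=
  ereal_sup [set (\sum_(H in C) y H)%:E | y in @fractional_packing C]%classic.

Definition integral_blocking C : Prop := fpn C = bn C.

Definition dot_ind x (H : {set E}) : R := \sum_(e in H) x e.

Definition convex_hull (S : set {ffun E -> R}) : set {ffun E -> R} := fun x =>
  exists (n : nat) (p : 'I_n -> {ffun E -> R}) (w : 'I_n -> R),
    [/\ forall i, S (p i), forall i, 0 <= w i, \sum_i w i = 1
      & forall e, x e = \sum_i w i * p i e].

(* A polyhedron is integral when it is the convex hull of its integral points.
   The two predicates below are only applied to sets that are polyhedra by
   construction. *)
Definition integral_polyhedron (P : set {ffun E -> R}) : Prop :=
  P = convex_hull (fun x => P x /\ forall e, x e \is a Num.int).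

Definition integral_polytope (P : set {ffun E -> R}) : Prop :=
  (exists M : R, forall x, P x -> forall e, `|x e| <= M) /\
  integral_polyhedron P.

Definition ideal C : Prop :=
  integral_polyhedron (fun x =>
    (forall e, 0 <= x e) /\ (forall H, H \in C -> 1 <= dot_ind x H)).

Definition blocking_polyhedron C : set {ffun E -> R} := fun x =>
  [/\ forall T, T \in min_transversals C -> dot_ind x T = 1,
      forall T, T \in transversals C -> 1 <= dot_ind x T
    & forall e, 0 <= x e].

Definition nonseparable C : Prop :=
  ~ exists E1 E2 : {set E},
      [/\ E1 != finset.set0, E2 != finset.set0, [disjoint E1 & E2],
          E1 :|: E2 = [set: E]%SET
        & bn C = (bn (restrict C E1) + bn (restrict C E2))%E].

Definition precore C : Prop :=
  [/\ clutter C, C = core C, integral_blocking C,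
      integral_polytope (blocking_polyhedron C) & nonseparable C].

End Numbers.

(* Main.v *)
(** A nontrivial minor of the minimally non-packing clutter [D] packs, so
    [pn (D / A \ B) = bn (D / A \ B)].  As [C] is a subfamily of [D], every
    member of [C / A \ B] contains a member of [D / A \ B]; hence a transversal
    of the latter meets every member of the former, and
    [bn (C / A \ B) <= bn (D / A \ B)]. *)
Require Import Defs.
From mathcomp Require Import all_boot all_order all_algebra.
From mathcomp Require Import boolp classical_sets reals constructive_ereal ereal.

Section Refinement.
Import Order.TTheory Num.Theory.
Variable E : finType.
Implicit Types C D : {set {set E}}.

(** Unlike the inclusion of [C] in [D], this relation survives contraction: a minimal [X :\: A] for
    [C] may stop being minimal for a larger [D]. *)
Definition refines D C : Prop :=
  forall X, X \in C -> exists2 Y, Y \in D & Y \subset X.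

Lemma refines_contraction D C (A : {set E}) :
  refines D C -> refines (contraction D A) (contraction C A).
Proof.
move=> DC X; rewrite inE => /minsetp /imsetP[X0 /DC[Y0 Y0D Y0X0] ->].
have Y0A : mem [set Y :\: A | Y in D] (Y0 :\: A) by apply/imsetP; exists Y0.
have [Y Ymin YY0] := minset_exists Y0A.
by exists Y; [rewrite inE | exact/(fintype.subset_trans YY0)/finset.setSD].
Qed.

Lemma refines_deletion D C (B : {set E}) :
  refines D C -> refines (deletion D B) (deletion C B).
Proof.
move=> DC X; rewrite inE => /andP[/DC[Y YD YX] /eqP XB].
by exists Y; rewrite // inE YD -finset.subset0 -XB finset.setSI.
Qed.

Lemma le_bn (R : realType) D C : refines D C -> (bn R C <= bn R D)%E.
Proof.
move=> DC; apply: le_ereal_inf_tmp => _ [T + <-]; rewrite /= inE => /minsetp TD.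
have TC : meets_all C T.
  apply/forall_inP => X /DC[Y YD YX]; move/forall_inP: TD => /(_ Y YD).
  by apply: contraNneq => XT; rewrite -finset.subset0 -XT finset.setSI.
(* [T] need not be minimal for [C]; shrinking it to a transversal [S] does not increase its size. *)
have [S Smin ST] := minset_exists TC.
apply: (@le_trans _ _ ((#|S|%:R)%R%:E : \bar R)).
  by apply: ereal_inf_lbound; exists S; rewrite //= inE.
by rewrite lee_fin ler_nat subset_leq_card.
Qed.

(** Properness is read off the ground set, here the complement of the nonempty [A :|: B];
    disjointness keeps [B] inside the ground set left after contracting [A]. *)
Lemma proper_minor_contract_delete C (A B : {set E}) :
  [disjoint A & B] -> A :|: B != finset.set0 ->
  proper_minor C (deletion (contraction C A) B).
Proof.
move=> dAB nAB; exists (([set: E] :\: A) :\: B)%SET.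
  apply: minor_delete; first by apply: minor_contract (minor_refl _) (finset.subsetT _).
  by rewrite finset.setTD -finset.disjoints_subset disjoint_sym.
apply: contraNneq nAB; rewrite finset.setDDl finset.setTD => /(congr1 (@finset.setC E)).
by rewrite finset.setCK finset.setCT => ->.
Qed.

End Refinement.

Theorem theorem4p2 (R : realType) (E : finType) (C D : {set {set E}}) :
  precore R C ->
  clutter D -> ideal R D -> minimally_nonpacking R D -> core D = C ->
  forall A B : {set E}, [disjoint A & B] -> A :|: B != finset.set0 ->
  (bn R (deletion (contraction C A) B) <= pn R (deletion (contraction D A) B))%E.
Proof.
move=> _ _ _ [_ minors_pack] <- A B dAB nAB.
rewrite (minors_pack _ (proper_minor_contract_delete _ _ _ _ dAB nAB)).
apply/le_bn/refines_deletion/refines_contraction => X.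
by rewrite inE => /andP[XD _]; exists X.
Qed.
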